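(* Let $k$ be an infinite field. Let $(\mathcal{A}_n)_{n\ge 1}$ be a sequence of line arrangements in $\mathbb{P}^2_k$, where $\mathcal{A}_n$ consists of $l(n)$ lines, such that $\lim_{n\to\infty} \frac{\bar{c}_1^2(\mathcal{A}_n)}{\bar{c}_2(\mathcal{A}_n)} = c > 2$ and $\lim_{n\to\infty} l(n)=\infty$. Assume that there is a real number $h$ with $1<h\le 2$ such that $\lim_{n\to\infty} \frac{\bar{c}_1^2(\mathcal{A}_n)}{l(n)^h}=a$ for some real number $a>0$. Then the Chern slopes of line arrangements over $k$ are dense in the interval $[2,c]$.
   Context: A line in $\mathbb{P}^2_k$ is a set $\{[x,y,z]\in\mathbb{P}^2_k : ax+by+cz=0\}$ with $a,b,c\in k$ not all zero. A line arrangement over $k$ is a finite collection of two or more (distinct) lines in $\mathbb{P}^2_k$. For an arrangement $\mathcal{A}$ of $d$ lines and $m\ge 2$, $t_m$ denotes the number of points of $\mathbb{P}^2_k$ lying on exactly $m$ lines of $\mathcal{A}$. The Chern numbers of $\mathcal{A}$ are $$\bar{c}_1^2(\mathcal{A})= 9-5d+\sum_{m \geq 2} (3m-4) t_m, \qquad \bar{c}_2(\mathcal{A})= 3-2d + \sum_{m \geq 2} (m-1) t_m.$$ Standing assumption: all arrangements of $d$ lines considered satisfy $t_d=t_{d-1}=0$ (for such arrangements $\bar{c}_2>0$). The Chern slope of such an arrangement is $\bar{c}_1^2(\mathcal{A})/\bar{c}_2(\mathcal{A})$. ''Chern slopes of line arrangements over $k$ are dense in $[2,c]$'' means that the closure in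 $\mathbb{R}$ of the set of Chern slopes of all line arrangements over $k$ (with $t_d=t_{d-1}=0$) contains $[2,c]$. *)

(* Defs.v *)
From HB Require Import structures.
From mathcomp Require Import all_boot all_order all_algebra.
From mathcomp Require Import finmap generic_quotient.
From mathcomp Require Import all_classical all_reals all_analysis.

Set Implicit Arguments.
Unset Strict Implicit.
Unset Printing Implicit Defensive.

Import Order.TTheory GRing.Theory Num.Theory.
Import numFieldNormedType.Exports.

Local Open Scope quotient_scope.
Local Open Scope classical_set_scope.
Local Open Scope ring_scope.

Definition coords (k : fieldType) : Type := {v : 'rV[k]_3 | v != 0}.
HB.instance Definition _ (k : fieldType) := Choice.on (coords k).

Definition proportional (k : fieldType) (v w : coords k) : bool :=
  `[< exists2 c : k, c != 0 & val w = c *: val v >].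

Lemma proportional_equiv (k : fieldType) :
  equiv_class_of (@proportional k).
Proof.
split=> [v | v w | w v x].
- by apply/asboolP; exists 1; rewrite ?oner_eq0 ?scale1r.
- by apply/asbool_equiv_eq; split=> -[c c0 ->]; exists c^-1;
    rewrite ?invr_eq0 ?scalerK.
- move=> /asboolP[c c0 wE] /asboolP[e e0 xE]; apply/asboolP.
  by exists (e * c); rewrite ?mulf_neq0 // xE wE scalerA.
Qed.

Canonical proportional_equiv_rel (k : fieldType) :=
  EquivRelPack (proportional_equiv k).

(* The projective plane (k^3 \ {0}) / k^*; \pi_(P2 k) v is the point [v]. *)
Definition P2 (k : fieldType) : Type := {eq_quot @proportional k}.
HB.instance Definition _ (k : fieldType) := EqQuotient.on (P2 k).

Definition is_line (k : fieldType) (L : set (P2 k)) : Prop :=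
  exists2 u : 'rV[k]_3, u != 0 &
    L = [set \pi_(P2 k) v | v in
          [set v : coords k | \sum_i u 0 i * val v 0 i = 0]].

Record arrangement (k : fieldType) : Type := Arrangement {
  lines : {fset (set (P2 k))};
  lines_are_lines : forall L, L \in lines -> is_line L;
  lines_ge2 : (2 <= #|` lines|)%N }.

Section ChernNumbers.
Variables (k : fieldType) (A : arrangement k).

Definition nlines : nat := #|` lines A|.

Definition mult (p : P2 k) : nat := #|` [fset L in lines A | p \in L]%fset|.

(* For m < 2 the set below is infinite when k is, and fset_set then returns the
   empty set; tm is only meaningful, and only used, for m >= 2. *)
Definition tm (m : nat) : nat := #|` fset_set [set p | mult p = m]|.

(* No point lies on more than d lines, so the sums over m >= 2 stop at d. *)
Definition chern1sq : int :=
  9 - 5 * nlines%:Z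
  + \sum_(2 <= m < nlines.+1) (3 * m%:Z - 4) * (tm m)%:Z.

Definition chern2 : int :=
  3 - 2 * nlines%:Z + \sum_(2 <= m < nlines.+1) (m%:Z - 1) * (tm m)%:Z.

(* The standing assumption t_d = t_{d-1} = 0.  For d = 2 it fails because
   t_2 = 1, whatever the value of the irrelevant t_1. *)
Definition admissible : Prop := tm nlines = 0%N /\ tm nlines.-1 = 0%N.

Definition chern_slope (R : realType) : R := chern1sq%:~R / chern2%:~R.

End ChernNumbers.

Definition chern_slopes (R : realType) (k : fieldType) : set R :=
  [set chern_slope A R | A in [set A : arrangement k | admissible A]].
Arguments chern_slopes : clear implicits.

(* Main.v *)
(* Over an infinite field there is a line avoiding the finitely many crossing
   points of a given arrangement.  Adding it to an arrangement of d lines creates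
   d new double points, so c_1^2 grows by 2d - 5 and c_2 by d - 2, and the new
   arrangement still satisfies t_d = t_{d-1} = 0.  Starting from A_n with n large
   and repeating this, c_1^2 - 2 c_2 drops by 1 each time, so the slope goes from
   near c to below 2.  Each step changes the slope by O(d / c_2), and d / c_2 is
   small at the start because c_2 grows like d^h with h > 1, and stays small
   because c_2 grows by d - 2 when d grows by 1; hence the slopes come close to
   every point of [2, c]. *)
Require Import Defs.
From mathcomp Require Import all_boot all_order all_algebra.
From mathcomp Require Import finmap generic_quotient.
From mathcomp Require Import all_classical all_reals all_analysis.
From mathcomp Require Import zify ring lra.

Set Implicit Arguments.
Unset Strict Implicit.
Unset Printing Implicit Defensive.

Import Order.TTheory GRing.Theory Num.Theory.
Import numFieldNormedType.Exports.
Local Open Scope classical_set_scope.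
Local Open Scope ring_scope.

(** * Incidence of points and lines in the projective plane *)

Section Geometry.
Context {k : fieldType}.
Implicit Types (u w : 'rV[k]_3) (p q : P2 k) (L : set (P2 k)).
Local Open Scope quotient_scope.

Lemma dotE u w : (\sum_i u 0 i * w 0 i == 0) = (u *m w^T == 0).
Proof.
have <- : (u *m w^T) 0 0 = \sum_i u 0 i * w 0 i.
  by rewrite mxE; apply: eq_bigr => l _; rewrite mxE.
apply/eqP/eqP => [h|->]; last by rewrite mxE.
by apply/matrixP => i j; rewrite !ord1 h mxE.
Qed.

Definition line_of u : set (P2 k) :=
  [set \pi_(P2 k) v | v in
    [set v : coords k | \sum_i u 0 i * val v 0 i = 0]].

Lemma pi_proportional (v w : coords k) :
  \pi_(P2 k) v = \pi_(P2 k) w <-> exists2 e : k, e != 0 & val w = e *: val v.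
Proof.
split=> [/eqP|h]; first by rewrite eqmodE => /asboolP.
by apply/eqP; rewrite eqmodE; apply/asboolP.
Qed.

Lemma mem_line_of u (v : coords k) :
  line_of u (\pi_(P2 k) v) <-> u *m (val v)^T = 0.
Proof.
split=> [[w /= uw /esym/pi_proportional[e e0 wE]]|uv].
  have /eqP : u *m (val w)^T = 0 by apply/eqP; rewrite -dotE uw.
  by rewrite wE linearZ -scalemxAr scaler_eq0 (negPf e0) => /eqP.
by exists v => //=; apply/eqP; rewrite dotE uv.
Qed.

(** Independent [x] and [y] span a space of rank at least 2, so the vectors orthogonal to both form
    a space of rank at most 1, spanned by the nonzero [u]. *)
Lemma common_kernel_sub (u w x y : 'rV[k]_3) : x != 0 -> u != 0 -> w != 0 ->
  ~~ (y <= x)%MS ->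
  u *m x^T = 0 -> u *m y^T = 0 -> w *m x^T = 0 -> w *m y^T = 0 ->
  (w <= u)%MS.
Proof.
move=> x0 u0 w0 yx ux uy wx wy.
pose V := (x + y)%MS.
have rV : (2 <= \rank V)%N.
  rewrite ltnNge; apply: contra yx => rV.
  have xV : (x <= V)%MS by exact: addsmxSl.
  apply: submx_trans (addsmxSr x y) _.
  by rewrite -(geq_leqif (mxrank_leqif_sup xV)) rank_rV x0.
have subK (z : 'rV[k]_3) : z *m x^T = 0 -> z *m y^T = 0 -> (z <= kermx V^T)%MS.
  move=> zx zy; apply/sub_kermxP; apply: trmx_inj.
  rewrite trmx_mul trmxK trmx0; apply/eqP; rewrite -submx0.
  have zxT : x *m z^T = 0 by rewrite -[x]trmxK -trmx_mul zx trmx0.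
  have zyT : y *m z^T = 0 by rewrite -[y]trmxK -trmx_mul zy trmx0.
  by rewrite /V addsmxMr zxT zyT addsmx_sub !sub0mx.
have uK := subK _ ux uy; have wK := subK _ wx wy.
have rK : (\rank (kermx V^T) <= 1)%N.
  by rewrite mxrank_ker mxrank_tr leq_subLR (leq_add rV (leqnn 1)).
apply: submx_trans wK _.
by rewrite -(geq_leqif (mxrank_leqif_sup uK)) rank_rV u0.
Qed.

Lemma lines_meet_once L L' p q : is_line L -> is_line L' -> L <> L' ->
  L p -> L' p -> L q -> L' q -> p = q.
Proof.
move=> [u u0 ->] [w w0 ->] uw.
rewrite -/(line_of u) -/(line_of w) in uw *.
rewrite -[p]reprK -[q]reprK; move: (repr p) (repr q) => v x.
move=> /mem_line_of uv /mem_line_of wv /mem_line_of ux /mem_line_of wx.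
(* Dependent representatives give the same point; independent ones would make [w] a multiple of [u],
   hence the lines equal. *)
have [/sub_rVP[e xE]|xv] := boolP (val x <= val v)%MS.
  apply/pi_proportional; exists e => //.
  by apply: contraTneq (valP x) => e0; rewrite xE e0 scale0r eqxx.
have sub z t := @common_kernel_sub z t (val v) (val x) (valP v).
case: uw; have /sub_rVP[e wE] : (w <= u)%MS by exact: sub.
have e0 : e != 0 by apply: contraNneq w0 => e0; rewrite wE e0 scale0r.
apply/seteqP; split=> y; rewrite -[y]reprK => /mem_line_of h;
  apply/mem_line_of; move: h.
  by rewrite wE -scalemxAl => ->; rewrite scaler0.
by rewrite wE -scalemxAl => /eqP; rewrite scaler_eq0 (negPf e0) => /eqP.
Qed.

Lemma lines_meet L L' : is_line L -> is_line L' -> (L `&` L') !=set0.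
Proof.
move=> [u u0 ->] [w w0 ->]; rewrite -/(line_of u) -/(line_of w).
(* A 3 by 2 matrix has a nonzero left kernel, and any nonzero vector in it represents a common
   point. *)
pose K := kermx (row_mx u^T w^T).
have K0 : K != 0.
  rewrite -mxrank_eq0 mxrank_ker subn_eq0 -ltnNge.
  exact: leq_ltn_trans (rank_leq_col _) _.
have v0 := nz_row_eq0 K; rewrite (negPf K0) in v0.
have vK : nz_row K *m row_mx u^T w^T = 0.
  by apply/sub_kermxP; exact: nz_row_sub.
pose v : coords k := exist _ (nz_row K) (negbT v0).
move: vK; rewrite mul_mx_row -[0]hsubmxK => /eq_row_mx[].
rewrite !linear0 => vu vw.
by exists (\pi_(P2 k) v); split; apply/mem_line_of; apply: trmx_inj;
  rewrite trmx_mul trmxK trmx0.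
Qed.

(* The lines with coordinates [1, t, t^2] through a given point correspond to
   the roots of a nonzero quadratic polynomial in t. *)
Lemma line_avoiding (S : set (P2 k)) : infinite_set [set: k] ->
  finite_set S -> exists2 L, is_line L & forall p, S p -> ~ L p.
Proof.
move=> kinf Sfin.
pose P : {poly k} := \prod_(p <- fset_set S) rVpoly (val (repr p)).
have P0 : P != 0.
  rewrite prodf_seq_neq0; apply/allP => p _ /=.
  apply: contraNneq (valP (repr p)) => h.
  by rewrite -[val _]rVpolyK h linear0.
have [t Pt] : exists t, ~~ root P t.
  (* A subset with at least [size P] elements is too large to consist of roots of the nonzero
     [P]. *)
  have [B _ PB] := infinite_set_fset (size P) kinf.
  apply: contrapT => Pt; move: PB; rewrite leqNgt => /negP; apply.
  apply: max_poly_roots P0 _ (fset_uniq B); apply/allP => t _.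
  by apply: contrapT => h; apply: Pt; exists t; apply/negP.
pose u : 'rV[k]_3 := \row_i t ^+ i.
exists (line_of u).
  exists u => //; apply/eqP => /rowP /(_ ord0); rewrite !mxE expr0 => /eqP.
  by rewrite oner_eq0.
move=> p Sp; rewrite -[p]reprK => /mem_line_of up.
move: Pt; rewrite /root horner_prod prodf_seq_neq0 => /allP /(_ p).
rewrite in_fset_set // mem_set // => /(_ isT) /= /eqP; apply.
rewrite horner_poly; move/eqP: up; rewrite -dotE => /eqP up; rewrite -[RHS]up.
by apply: eq_bigr => i _; rewrite valK mxE mulrC.
Qed.
End Geometry.

(** * Effect of a generic line on multiplicities and Chern numbers *)

Section AddLine.
Context {k : fieldType}.
Implicit Types (A : arrangement k) (p : P2 k) (L : set (P2 k)).

Lemma multP A p : (2 <= mult A p)%N <->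
  exists L L', [/\ L \in lines A, L' \in lines A, L <> L', L p & L' p].
Proof.
rewrite /mult; set F := [fset L in lines A | p \in L]%fset.
have FE L : (L \in F) = (L \in lines A) && (p \in L) by rewrite !inE.
split=> [F2|[L [L' [AL AL' LL' Lp L'p]]]].
  have /fset0Pn[L LF] : F != fset0 by rewrite -cardfs_gt0; exact: ltn_trans F2.
  have /fset0Pn[L' ] : (F `\ L)%fset != fset0.
    by rewrite -cardfs_gt0; move: F2; rewrite (cardfsD1 L) LF.
  rewrite in_fsetD1 FE => /and3P[LL' AL' /set_mem L'p].
  move: LF; rewrite FE => /andP[AL /set_mem Lp].
  by exists L, L'; split=> //; apply/eqP; rewrite eq_sym.
have sub : ([fset L; L'] `<=` F)%fset.
  apply/fsubsetP => M; rewrite in_fset2 FE => /orP[]/eqP ->.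
    by rewrite AL mem_set.
  by rewrite AL' mem_set.
apply: leq_trans (fsubset_leq_card sub).
by rewrite cardfs2; move/eqP: LL' => ->.
Qed.

Lemma mult_leq A p : (mult A p <= nlines A)%N.
Proof. by apply/fsubset_leq_card/fsubsetP => L; rewrite !inE => /andP[]. Qed.

Lemma tm_gt A m : (nlines A < m)%N -> tm A m = 0%N.
Proof.
move=> Am; rewrite /tm [X in fset_set X](_ : _ = set0) ?fset_set0 //.
by apply/seteqP; split=> // p /= pm; have := mult_leq A p; lia.
Qed.

(** Crossing points lie in the finite union of the intersections of two distinct lines, each a
    single point. *)
Lemma finite_crossings A : finite_set [set p | (2 <= mult A p)%N].
Proof.
apply: (@sub_finite_set _ _ (\bigcup_(L in [set` lines A])
  \bigcup_(L' in [set` lines A] `\ L) (L `&` L'))).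
  move=> p /multP[L [L' [AL AL' LL' Lp L'p]]].
  by exists L => //; exists L' => //; split=> //= /esym.
apply: bigcup_finite => [|L AL]; first exact: finite_fset.
apply: bigcup_finite => [|L' [AL' LL']].
  exact/finite_setD/finite_fset.
have lL := lines_are_lines AL; have lL' := lines_are_lines AL'.
have [q [Lq L'q]] := lines_meet lL lL'.
apply: (@sub_finite_set _ _ [set q]) => // p [Lp L'p].
by apply: (lines_meet_once lL lL') => // /esym.
Qed.

Lemma generic_line A : infinite_set [set: k] ->
  exists2 L, is_line L & forall p, L p -> (mult A p <= 1)%N.
Proof.
move=> kinf; have [L lL hL] := line_avoiding kinf (finite_crossings A).
by exists L => // p Lp; rewrite leqNgt; apply/negP => /hL.
Qed.

(** A member [L] would meet some other line of [A] in a point of multiplicity at least 2. *)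
Lemma generic_line_notin A L : is_line L ->
  (forall p, L p -> (mult A p <= 1)%N) -> L \notin lines A.
Proof.
move=> lL hL; apply/negP => AL.
have /fset0Pn[L'] : (lines A `\ L)%fset != fset0.
  by rewrite -cardfs_gt0; move: (lines_ge2 A); rewrite (cardfsD1 L) AL.
rewrite in_fsetD1 => /andP[/eqP LL' AL'].
have [q [Lq L'q]] := lines_meet lL (lines_are_lines AL').
suff : (2 <= mult A q)%N by rewrite ltnNge hL.
by apply/multP; exists L, L'; split=> // /esym.
Qed.

Section Generic.
Variables (A B : arrangement k) (L : set (P2 k)).
Hypotheses (lineL : is_line L) (generic : forall p, L p -> (mult A p <= 1)%N).
Hypothesis (linesB : lines B = (L |` lines A)%fset).

Let LnotinA : L \notin lines A. Proof. exact: generic_line_notin. Qed.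

Lemma nlines_add : nlines B = (nlines A).+1.
Proof. by rewrite /nlines linesB cardfsU1 LnotinA. Qed.

Lemma mult_add p : mult B p = ((p \in L) + mult A p)%N.
Proof.
rewrite /mult linesB; have [pL|pL] /= := boolP (p \in L).
  rewrite -[RHS](_ : #|` L |` [fset M in lines A | p \in M]| = _)%fset.
    congr (#|` _|); apply/fsetP => M; rewrite !inE.
    by case: eqP => //= ->.
  by rewrite cardfsU1 !inE (negPf LnotinA).
rewrite add0n; congr (#|` _|); apply/fsetP => M; rewrite !inE.
by case: eqP => //= ->; rewrite (negPf pL) andbF.
Qed.

(** Only points of [L] change multiplicity, and theirs stays at most 2. *)
Lemma tm_add m : (2 < m)%N -> tm B m = tm A m.
Proof.
move=> m2; rewrite /tm; congr (#|` fset_set _|); apply/funext => p /=.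
rewrite mult_add; have [/set_mem pL|//] := boolP (p \in L).
have Ap := generic pL; apply/propext; split; lia.
Qed.

(** Intersecting with [L] maps the lines of [A] bijectively onto these points: two lines with the
    same image would cross on [L], against genericity. *)
Lemma card_simple_points :
  finite_set [set p | L p /\ mult A p = 1%N] /\
  #|` fset_set [set p | L p /\ mult A p = 1%N]| = nlines A.
Proof.
(* The membership condition sits under the existential so that [choice] yields a total function;
   outside [lines A] its value is irrelevant. *)
have meet M : exists p, M \in lines A -> L p /\ M p.
  have [AM|] := boolP (M \in lines A); last first.
    by have [p _] := lines_meet lineL lineL; exists p.
  by have [p] := lines_meet lineL (lines_are_lines AM); exists p.
have [g gP] := choice meet.
have LM M : M \in lines A -> L <> M.
  by move=> AM LM; move: LnotinA; rewrite LM AM.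
have -> : [set p | L p /\ mult A p = 1%N] =
    [set` [fset g M | M in lines A]%fset].
  apply/seteqP; split=> [p [Lp]|p /imfsetP[M /= AM ->]].
    rewrite /mult => /eqP/cardfs1P[M ME].
    have : M \in [fset M in lines A | p \in M]%fset by rewrite ME in_fset1.
    rewrite !inE => /andP[AM /set_mem Mp]; apply/imfsetP; exists M => //.
    have [Lg Mg] := gP _ AM.
    exact: (lines_meet_once lineL (lines_are_lines AM) (LM _ AM)).
  have [Lg Mg] := gP _ AM; split=> //; apply/eqP; rewrite eqn_leq generic //.
  rewrite /mult cardfs_gt0; apply/fset0Pn; exists M.
  by rewrite !inE AM mem_set.
split; first exact: finite_fset.
rewrite set_fsetK card_in_imfset // => M M' /= AM AM' gE.
apply: contrapT => MM'.
have [Lg Mg] := gP _ AM; have [_ Mg'] := gP _ AM'; rewrite -gE in Mg'.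
suff : (2 <= mult A (g M))%N by rewrite ltnNge generic.
by apply/multP; exists M, M'.
Qed.

(** Double points of [A] lie off [L] and survive; the new ones are the simple points of [A] on
    [L]. *)
Lemma tm2_add : tm B 2 = (tm A 2 + nlines A)%N.
Proof.
have [fS cS] := card_simple_points; rewrite -cS /tm.
have f2 : finite_set [set p | mult A p = 2%N].
  by apply: sub_finite_set (finite_crossings A) => p /= ->.
rewrite [X in fset_set X](_ : _ =
  [set p | mult A p = 2%N] `|` [set p | L p /\ mult A p = 1%N]); last first.
  apply/funext => p /=; rewrite mult_add; apply/propext.
  have [/set_mem pL|/negP pL] := boolP (p \in L).
    have Ap := generic pL; split=> [mp|[|[]]]; [right; split=> //|..]; lia.
  by split=> [|[//|[/mem_set]]//]; left.
rewrite fset_setU // cardfsU [X in (_ - X)%N](_ : _ = 0%N) ?subn0 //.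
rewrite -fset_setI //; apply/eqP; rewrite cardfs_eq0; apply/eqP.
rewrite [X in fset_set X](_ : _ = set0) ?fset_set0 //.
by apply/seteqP; split=> // p [/= ->] [].
Qed.

Lemma sum_tm_add (F : nat -> int) :
  \sum_(2 <= m < (nlines B).+1) F m * (tm B m)%:Z =
  \sum_(2 <= m < (nlines A).+1) F m * (tm A m)%:Z + F 2 * (nlines A)%:Z.
Proof.
have A2 : (2 <= nlines A)%N := lines_ge2 A.
(* The longer range adds only the index [(nlines A).+1], where [tm A] vanishes; the sums then differ
   only at index 2. *)
rewrite nlines_add big_nat_recr ?leqW //= (@tm_add (nlines A).+1) // tm_gt //.
rewrite mulr0 addr0 big_ltn // [in RHS]big_ltn // tm2_add.
under eq_big_nat => m /andP[m2 _] do rewrite tm_add //.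
by rewrite PoszD mulrDr; ring.
Qed.

Lemma chern1sq_add : chern1sq B = chern1sq A + 2 * (nlines A)%:Z - 5.
Proof. by rewrite /chern1sq sum_tm_add nlines_add; ring. Qed.

Lemma chern2_add : chern2 B = chern2 A + (nlines A)%:Z - 2.
Proof. by rewrite /chern2 sum_tm_add nlines_add; ring. Qed.

Lemma admissible_add : (2 < nlines A)%N -> admissible A -> admissible B.
Proof.
move=> A2 [tA _]; rewrite /admissible nlines_add /=.
by split; rewrite tm_add // ?tm_gt //; lia.
Qed.

End Generic.

Lemma exists_add_line A : infinite_set [set: k] ->
  (2 < nlines A)%N -> admissible A ->
  exists B : arrangement k, [/\ admissible B, nlines B = (nlines A).+1,
    chern1sq B = chern1sq A + 2 * (nlines A)%:Z - 5 &
    chern2 B = chern2 A + (nlines A)%:Z - 2].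
Proof.
move=> kinf A2 admA; have [L lL gL] := generic_line A kinf.
have linesB M : M \in (L |` lines A)%fset -> is_line M.
  by rewrite in_fset1U => /orP[/eqP->//|]; exact: lines_are_lines.
have B2 : (2 <= #|` L |` lines A|%fset)%N.
  by rewrite cardfsU1; apply: leq_trans (lines_ge2 A) (leq_addl _ _).
exists (Arrangement linesB B2); split.
- exact: (admissible_add lL gL).
- exact: (nlines_add lL gL).
- exact: (chern1sq_add lL gL).
- exact: (chern2_add lL gL).
Qed.

End AddLine.

(** * Slope estimates and density *)

(* Each added line lowers [chern1sq - 2 * chern2] by 1, so the slope eventually
   drops below 2; the first slope below [x + e] cannot have jumped past [x]. *)
Lemma slope_descent (R : realType) (k : fieldType) (N : nat)
    (A : arrangement k) (e M x : R) :
  infinite_set [set: k] -> 0 < e -> 2 <= M -> 2 <= x ->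
  admissible A -> (2 < nlines A)%N ->
  M <= e * ((nlines A)%:R - 2) ->
  M * (nlines A)%:R <= e * (chern2 A)%:~R ->
  (chern1sq A)%:~R <= M * (chern2 A)%:~R ->
  x - e < chern_slope A R -> chern1sq A - 2 * chern2 A < N%:Z ->
  exists2 B : arrangement k, admissible B & `|x - chern_slope B R| < e.
Proof.
move=> kinf e0 M2 x2.
elim: N A => [|N IH] A admA A3 hMd hMc hcM xs hN;
  have d3 : 3 <= (nlines A)%:R :> R by rewrite (ler_nat R 3).
all: have c2_gt0 : 0 < (chern2 A)%:~R :> R by
  rewrite -(pmulr_rgt0 _ e0); apply: lt_le_trans hMc; apply: mulr_gt0; lra.
all: have [sx|xs'] := ltP (chern_slope A R) (x + e);
  first by exists A => //; rewrite ltr_distlC; apply/andP; split; lra.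
  (* For [N = 0] the bound [hN] contradicts a slope of at least [x + e], which exceeds 2. *)
  have : 2 < chern_slope A R by lra.
  rewrite /chern_slope ltr_pdivlMr // -(intrM R 2) ltr_int.
  by move: hN; move: (chern1sq A) (chern2 A) => p q; clear; lia.
have [B [admB dB c1B c2B]] := exists_add_line kinf A3 admA.
have dBR : (nlines B)%:R = (nlines A)%:R + 1 :> R by rewrite dB -natr1.
have c1BR : (chern1sq B)%:~R = (chern1sq A)%:~R + 2 * (nlines A)%:R - 5 :> R.
  by rewrite c1B rmorphB rmorphD rmorphM.
have c2BR : (chern2 B)%:~R = (chern2 A)%:~R + (nlines A)%:R - 2 :> R.
  by rewrite c2B rmorphB rmorphD.
(* The sum of [hMc] and [hMd]. *)
have hMcB : M * (nlines B)%:R <= e * (chern2 B)%:~R by rewrite dBR c2BR; lra.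
have c2B_gt0 : 0 < (chern2 B)%:~R :> R by rewrite c2BR; lra.
apply: (IH B) => //.
- by rewrite dB ltnW.
- by rewrite dBR; lra.
- by rewrite c1BR c2BR; nra.
(* One step lowers the slope [s] by less than [e]: with [d = nlines A], [s * (d - 2) <= M * (d - 2)
   < M * (d + 1) <= e * chern2 B], while [chern1sq] grows. *)
- apply: (@le_lt_trans _ _ (chern_slope A R - e - e)); first lra.
  apply: (@lt_trans _ _ (chern_slope A R - e)); first lra.
  rewrite {2}/chern_slope ltr_pdivlMr //.
  have sA : chern_slope A R * (chern2 A)%:~R = (chern1sq A)%:~R.
    by rewrite divfK // gt_eqF.
  have sM : chern_slope A R <= M by rewrite ler_pdivrMr.
  have : chern_slope A R * ((nlines A)%:R - 2) <= M * ((nlines A)%:R - 2).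
    by apply: ler_wpM2r => //; lra.
  move: hMcB; rewrite dBR c1BR c2BR => hMcB.
  by lra.
- rewrite c1B c2B; move: hN; move: (chern1sq A) (chern2 A) (nlines A) => p q d.
  by clear; lia.
Qed.

(** Eventually [v] exceeds [a / 2 * u ^ h], and [u ^ h = u * u ^ (h - 1)] outgrows every multiple of
    [u] because [h > 1]. *)
Lemma cvg_infty_dominates (R : realType) (u : nat -> nat) (v : nat -> R)
    (h a K : R) : 1 < h -> 0 < a -> u n @[n --> \oo] --> \oo ->
  v n / (u n)%:R `^ h @[n --> \oo] --> a ->
  \forall n \near \oo, K * (u n)%:R <= v n.
Proof.
move=> h1 a0 uy va.
(* Chosen so that [K <= a / 2 * K']; the maximum with 1 keeps [K'] positive. *)
pose K' := Num.max 1 (2 * K / a).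
near=> n.
have Kr : K' `^ (h - 1)^-1 <= (u n)%:R.
  by near: n; exact: uy _ (nbhs_infty_ger _).
have K'0 : 0 < K' by rewrite lt_max ltr01.
have un0 : 0 < (u n)%:R :> R by apply: lt_le_trans Kr; exact: powR_gt0.
have hva : a / 2 < v n / (u n)%:R `^ h.
  by near: n; apply: (cvgr_gt a va); lra.
have K'u : K' <= (u n)%:R `^ (h - 1).
  have -> : K' = (K' `^ (h - 1)^-1) `^ (h - 1).
    have h0 : h - 1 != 0 by rewrite subr_eq0 gt_eqF.
    by rewrite -powRrM mulVf // powRr1 // ltW.
  by apply: ge0_ler_powR;
    rewrite ?nnegrE ?powR_ge0 ?(ltW un0) ?subr_ge0 ?(ltW h1).
have powE : (u n)%:R `^ h = (u n)%:R * (u n)%:R `^ (h - 1).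
  rewrite -[in LHS](subrK 1 h) [in LHS]powRD; last first.
    by rewrite (gt_eqF un0) implybT.
  by rewrite powRr1 ?(ltW un0) // mulrC.
rewrite ltr_pdivlMr ?powR_gt0 // powE in hva.
apply: le_trans (ltW hva).
have KK' : K <= a / 2 * K'.
  have : 2 * K / a <= K' by rewrite le_max lexx orbT.
  by rewrite ler_pdivrMr //; lra.
have : a / 2 * K' <= a / 2 * (u n)%:R `^ (h - 1) by rewrite ler_pM2l //; lra.
move=> h2; rewrite mulrCA [_ * (u n)%:R]mulrC ler_pM2l //.
exact: le_trans h2.
Unshelve. all: by end_near.
Qed.

Theorem lemma4p2 (R : realType) (k : fieldType)
    (k_infinite : infinite_set [set: k])
    (A : nat -> arrangement k) (c h a : R)
    (A_admissible : forall n, (1 <= n)%N -> admissible (A n))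
    (slope_cvg : (chern_slope (A n) R) @[n --> \oo] --> c)
    (c_gt2 : 2 < c)
    (lines_cvg : nlines (A n) @[n --> \oo] --> \oo)
    (h_gt1 : 1 < h) (h_le2 : h <= 2)
    (a_gt0 : 0 < a)
    (growth : (chern1sq (A n))%:~R / (nlines (A n))%:R `^ h @[n --> \oo] --> a) :
  `[2, c] `<=` closure (chern_slopes R k).
Proof.
move=> x /=; rewrite in_itv /= => /andP[x2 xc] V /nbhs_ballP[e /= e0 eV].
pose M := c + 1.
(* The factor [M * (M / e)], with [chern1sq <= M * chern2], yields [hMc]; the maximum with 1 makes
   [chern1sq] positive; [2 + M / e] yields [hMd]. Distance below 1 from [c] keeps the slope positive
   and below [M]. *)
have [n [n1 [ns1 nse] nc1 [nd3 ndM]]] : exists n, [/\ (1 <= n)%N,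
    `|c - chern_slope (A n) R| < 1 /\ `|c - chern_slope (A n) R| < e,
    Num.max 1 (M * (M / e)) * (nlines (A n))%:R <= (chern1sq (A n))%:~R &
    (2 < nlines (A n))%N /\ 2 + M / e <= (nlines (A n))%:R].
  apply: (@filter_ex _ \oo); near=> n; split.
  - by near: n; exact: nbhs_infty_ge.
  - by split; near: n; move/cvgrPdist_lt : slope_cvg; apply.
  - by near: n; exact: cvg_infty_dominates growth.
  - split; near: n; first by move/cvgnyPge : lines_cvg; exact.
    exact: lines_cvg _ (nbhs_infty_ger _).
have nd0 : 0 < (nlines (A n))%:R :> R by rewrite ltr0n; apply: leq_trans nd3.
have c1_gt0 : 0 < (chern1sq (A n))%:~R :> R.
  by apply: lt_le_trans nc1; rewrite mulr_gt0 // lt_max ltr01.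
move: ns1 nse; rewrite !ltr_distlC => /andP[s1 s2] /andP[s3 s4].
(* The slope and its numerator are positive, hence so is the denominator. *)
have c2_gt0 : 0 < (chern2 (A n))%:~R :> R.
  rewrite -invr_gt0 -(pmulr_rgt0 _ c1_gt0); change (0 < chern_slope (A n) R).
  by lra.
have M0 : 0 < M by rewrite /M; lra.
have c1M : (chern1sq (A n))%:~R <= M * (chern2 (A n))%:~R :> R.
  by rewrite -ler_pdivrMr // ltW.
have M2 : 2 <= M by rewrite /M; lra.
have hMd : M <= e * ((nlines (A n))%:R - 2).
  by rewrite mulrC -ler_pdivrMr //; lra.
have hMc : M * (nlines (A n))%:R <= e * (chern2 (A n))%:~R.
  rewrite -(ler_pM2l M0); apply: (@le_trans _ _ (e * (chern1sq (A n))%:~R)).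
    have -> : M * (M * (nlines (A n))%:R) =
        e * (M * (M / e) * (nlines (A n))%:R).
      by field; rewrite gt_eqF.
    rewrite ler_pM2l //; apply: le_trans nc1.
    by rewrite ler_pM2r // le_max lexx orbT.
  by rewrite mulrCA ler_pM2l.
pose N := absz (chern1sq (A n) - 2 * chern2 (A n))%R.
have [||B admB Bx] := slope_descent (N := N.+1)
  k_infinite e0 M2 x2 (A_admissible n n1) nd3 hMd hMc c1M.
- by lra.
- by apply: le_lt_trans (ler_norm _) _; rewrite -abszE ltz_nat ltnSn.
by exists (chern_slope B R); split; [exists B | apply: eV; rewrite -ball_normE].
Unshelve. all: by end_near.
Qed.
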